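(* Let $G_0$ be the connected component of the identity of $\mathsf{GL}(2,\mathbb{R})$, with Lie algebra $\mathfrak{g}=\mathfrak{gl}(2,\mathbb{R})$, equipped with the bi-invariant Lorentzian metric $k^+$ determined by $k(u,v)=\mathrm{trace}(u\circ v)$ and its Levi-Civita connection $D$. With respect to the $k$-orthonormal basis $$e_1=\tfrac{\sqrt2}{2}\begin{pmatrix}0&1\\-1&0\end{pmatrix},\quad e_2=\tfrac{\sqrt2}{2}\begin{pmatrix}0&1\\1&0\end{pmatrix},\quad e_3=\tfrac{\sqrt2}{2}\begin{pmatrix}1&0\\0&-1\end{pmatrix},\quad e_4=\tfrac{\sqrt2}{2}\begin{pmatrix}1&0\\0&1\end{pmatrix},$$ the curvature tensor $R$, the sectional curvature $K$, the scalar curvature $S$, the Cartan-Killing form $B$ and the Ricci tensor $R_{icci}$ are given as follows. (Curvature tensor) $$R(e_1^+,e_2^+,e_1^+)=\tfrac12 e_2^+,\quad R(e_1^+,e_2^+,e_2^+)=\tfrac12 e_1^+,\quad R(e_1^+,e_3^+,e_1^+)=\tfrac12 e_3^+,\quad R(e_1^+,e_3^+,e_3^+)=\tfrac12 e_1^+,$$ $$R(e_2^+,e_1^+,e_1^+)=-\tfrac12 e_2^+,\quad R(e_2^+,e_1^+,e_2^+)=-\tfrac12 e_1^+,\quad R(e_2^+,e_3^+,e_2^+)=-\tfrac12 e_3^+,\quad R(e_2^+,e_3^+,e_3^+)=\tfrac12 e_2^+,$$ $$R(e_3^+,e_1^+,e_1^+)=-\tfrac12 e_3^+,\quad R(e_3^+,e_1^+,e_3^+)=-\tfrac12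 e_1^+,\quad R(e_3^+,e_2^+,e_2^+)=\tfrac12 e_3^+,\quad R(e_3^+,e_2^+,e_3^+)=-\tfrac12 e_2^+,$$ and $R(e_i^+,e_j^+,e_k^+)=0$ in all other cases. (Sectional curvature) $K(e_1^+,e_2^+)=K(e_1^+,e_3^+)=K(e_2^+,e_3^+)=-\tfrac12$ and $K(e_i^+,e_4^+)=0$ for $i=1,2,3$. (Scalar curvature) $S=-3$. (Cartan-Killing form) $B(e_1,e_1)=-4$, $B(e_2,e_2)=B(e_3,e_3)=4$, $B(e_4,e_4)=0$, and $B(e_i,e_j)=0$ for $i\neq j$. (Ricci tensor) $R_{icci}(e_1^+,e_1^+)=1$, $R_{icci}(e_2^+,e_2^+)=R_{icci}(e_3^+,e_3^+)=-1$, $R_{icci}(e_4^+,e_4^+)=0$, and $R_{icci}(e_i^+,e_j^+)=0$ for $i\neq j$.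
   Context: For $u\in\mathfrak{g}$, $u^+$ denotes the left-invariant vector field on $G_0$ with value $u$ at the identity, and $k^+$ is the left-invariant metric on $G_0$ with $k^+(u^+,v^+)=k(u,v)=\mathrm{trace}(u\circ v)$; it is bi-invariant. Its Levi-Civita connection satisfies $D_{u^+}v^+=\frac12[u,v]^+$, where $[u,v]=uv-vu$. The conventions used are: $$R(u^+,v^+,w^+)=R_{u^+v^+}w^+:=\tfrac14\big[[u^+,v^+],w^+\big],$$ $$K(u^+,v^+):=\frac14\,\frac{k^+([u^+,v^+],[u^+,v^+])}{k^+(u^+,u^+)k^+(v^+,v^+)-k^+(u^+,v^+)^2}\quad\text{when } \mathrm{span}\{u^+,v^+\}\text{ is nondegenerate},$$ $$S:=2\sum_{i<j}K(e_i^+,e_j^+),\qquad B(u,v):=\mathrm{trace}(\mathrm{ad}_u\circ\mathrm{ad}_v),\qquad R_{icci}(u^+,v^+):=-\tfrac14 B(u,v).$$ *)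

(* Defs.v *)
From HB Require Import structures.
From mathcomp Require Export all_boot all_order all_algebra.
From mathcomp Require Export all_classical all_reals all_analysis.
Export Order.TTheory GRing.Theory Num.Theory.
Export numFieldNormedType.Exports.

Set Implicit Arguments.
Unset Strict Implicit.
Unset Printing Implicit Defensive.

Local Open Scope classical_set_scope.
Local Open Scope ring_scope.

(* The open set GL(2,R) is viewed inside the normed space 'M[R]_2, so all its
   tangent spaces are identified with 'M[R]_2. *)
Definition G0 (R : realType) : set 'M[R]_2 :=
  connected_component [set g : 'M[R]_2 | g \in unitmx] 1%:M.

(* A vector field on G0 is given by its tangent-space coordinate, as a map on
   the whole of 'M[R]_2 of which only the restriction to the open set G0
   matters. *)
Definition vfield (R : realType) := 'M[R]_2 -> 'M[R]_2.

Section Lie_algebra.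
Variable R : realType.
Implicit Types u v w : 'M[R]_2.

Definition k u v : R := \tr (u *m v).

Definition ad u v : 'M[R]_2 := u *m v - v *m u.

Definition killing u v : R := \tr (lin_mx (fun w => ad u (ad v w))).

End Lie_algebra.

Section Lie_group.
Variable R : realType.
Implicit Types (u v x y g : 'M[R]_2) (X Y Z : vfield R).

(* The differential at 1 of the left translation by g, which is linear, is
   u |-> g *m u. *)
Definition left_inv u : vfield R := fun g => g *m u.

Definition kplus g x y : R := k (invmx g *m x) (invmx g *m y).

Definition bi_invariant (m : 'M[R]_2 -> 'M[R]_2 -> 'M[R]_2 -> R) : Prop :=
  forall g h x y, G0 g -> G0 h ->
    m (h *m g) (h *m x) (h *m y) = m g x y /\
    m (g *m h) (x *m h) (y *m h) = m g x y.

Definition lie X Y : vfield R := fun g => 'D_(X g) Y g - 'D_(Y g) X g.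

Definition differentiable_field X := forall g, G0 g -> differentiable X g.

(* Levi-Civita connections of kplus, acting on differentiable vector fields.
   Since fields are total maps, lc_local says that D only depends on the
   restrictions of the fields to G0. *)
Record levi_civita (D : vfield R -> vfield R -> vfield R) : Prop := LeviCivita {
  lc_local : forall X X' Y Y',
    (forall g, G0 g -> X g = X' g) -> (forall g, G0 g -> Y g = Y' g) ->
    forall g, G0 g -> D X Y g = D X' Y' g ;
  lc_linear : forall (f : 'M[R]_2 -> R) X X' Y, differentiable_field Y ->
    forall g, G0 g ->
    D (fun h => f h *: X h + X' h) Y g = f g *: D X Y g + D X' Y g ;
  lc_additive : forall X Y Y',
    differentiable_field Y -> differentiable_field Y' ->
    forall g, G0 g -> D X (fun h => Y h + Y' h) g = D X Y g + D X Y' g ;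
  lc_leibniz : forall (f : 'M[R]_2 -> R) X Y,
    (forall g, G0 g -> differentiable f g) -> differentiable_field Y ->
    forall g, G0 g ->
    D X (fun h => f h *: Y h) g = 'D_(X g) f g *: Y g + f g *: D X Y g ;
  lc_torsion_free : forall X Y,
    differentiable_field X -> differentiable_field Y ->
    forall g, G0 g -> D X Y g - D Y X g = lie X Y g ;
  lc_metric : forall X Y Z,
    differentiable_field X -> differentiable_field Y ->
    forall g, G0 g ->
    'D_(Z g) (fun h => kplus h (X h) (Y h)) g =
    kplus g (D Z X g) (Y g) + kplus g (X g) (D Z Y g)
}.

(* Sign convention R_{XY} Z = D_{[X,Y]} Z - [D_X, D_Y] Z. *)
Definition curvature_of (D : vfield R -> vfield R -> vfield R) X Y Z : vfield R :=
  fun g => D (lie X Y) Z g - (D X (D Y Z) g - D Y (D X Z) g).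

(* curv, sec_curv, scal_curv and ricci are the closed formulas valid for the
   left-invariant fields of a bi-invariant metric. *)
Definition curv X Y Z : vfield R := fun g => 4^-1 *: lie (lie X Y) Z g.

Definition sec_curv X Y g : R :=
  4^-1 * (kplus g (lie X Y g) (lie X Y g) /
    (kplus g (X g) (X g) * kplus g (Y g) (Y g) - kplus g (X g) (Y g) ^+ 2)).

Definition scal_curv (e : 'I_4 -> 'M[R]_2) g : R :=
  2 * \sum_(i < 4) \sum_(j < 4 | (i < j)%N)
        sec_curv (left_inv (e i)) (left_inv (e j)) g.

Definition ricci X Y g : R :=
  - (4^-1 * killing (invmx g *m X g) (invmx g *m Y g)).

End Lie_group.

Section Basis.
Variable R : realType.

Definition mx22 (a b c d : R) : 'M[R]_2 :=
  \matrix_(i, j) (if i == 0 then if j == 0 then a else b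
                  else if j == 0 then c else d).

Definition e1 : 'M[R]_2 := (Num.sqrt 2 / 2) *: mx22 0 1 (-1) 0.
Definition e2 : 'M[R]_2 := (Num.sqrt 2 / 2) *: mx22 0 1 1 0.
Definition e3 : 'M[R]_2 := (Num.sqrt 2 / 2) *: mx22 1 0 0 (-1).
Definition e4 : 'M[R]_2 := (Num.sqrt 2 / 2) *: mx22 1 0 0 1.

(* 0-based: e i is the basis vector labelled i + 1. *)
Definition e (i : 'I_4) : 'M[R]_2 := tnth [tuple e1; e2; e3; e4] i.

End Basis.
Arguments e1 {R}.
Arguments e2 {R}.
Arguments e3 {R}.
Arguments e4 {R}.
Arguments e {R} i.

(* Main.v *)
Require Import Defs.
From mathcomp Require Import all_boot all_order all_algebra.
From mathcomp Require Import ring lra.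
Set Implicit Arguments.
Unset Strict Implicit.
Local Open Scope classical_set_scope.
Local Open Scope ring_scope.

(** Everything reduces to algebra in gl(2,R).  On G0 the field [left_inv u] is
    the restriction of the linear map g |-> g *m u, so its directional
    derivative along [left_inv w] is g *m w *m u.  Hence the Lie bracket of two
    left-invariant fields is the left-invariant field of the commutator
    ([lie_left_inv]), while [kplus] of two of them is the constant trace form
    ([kplus_left_inv]).  The curvature expressions therefore depend only on
    the trace form [k], the commutator [ad] and the Killing form.

    The connection is found by Koszul's method ([koszul]).  For left-invariant
    fields the products k(X,Y) are locally constant around each point of G0,
    since invertible matrices form an open set; compatibility with the metric
    thus makes each D_w skew-symmetric for [k].  Together with the vanishing of
    torsion and the fact that k([u,v],w) is invariant under cyclic permutations
    ([k_ad_cyclic]), this gives 2 k(D_u v, w) = k([u,v],w), and [k] is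
    nondegenerate.  Substituting D_u v = [u,v]/2 into the definition of the
    curvature and applying the Jacobi identity leaves [[u,v],w]/4
    ([curvature_left_inv]).

    For the Killing form, the operator w |-> a w b has trace tr a tr b
    ([mxtrace_lin_mx_mul]); expanding ad_u ad_v into four such operators gives
    B(u,v) = 4 tr(uv) - 2 tr u tr v ([killingE]).

    What remains is the table of commutators of the orthonormal basis ([adE]):
    [e1,e2] = sqrt 2 e3, [e1,e3] = - sqrt 2 e2, [e2,e3] = - sqrt 2 e1, and e4
    is central. *)

(** * The trace form, the commutator and the Killing form *)

(** The operator is the Kronecker product of [a] and the transpose of [b]: the
    coefficient of the elementary matrix (i, j) in its own image is
    a i i * b j j. *)
Lemma mxtrace_lin_mx_mul (F : comPzRingType) m n (a : 'M[F]_m) (b : 'M[F]_n) :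
  \tr (lin_mx (fun w : 'M[F]_(m, n) => a *m w *m b)) = \tr a * \tr b.
Proof.
rewrite /mxtrace (reindex _ (curry_mxvec_bij m n)) /=.
rewrite big_distrlr pair_bigA; apply: eq_bigr => -[i j] _ /=.
rewrite !mxE /= vec_mx_delta mxvecE -(mul_delta_mx (0 : 'I_1)).
by rewrite mulmxA -colE -mulmxA -rowE mxE big_ord1 !mxE.
Qed.

Section LieAlgebra.
Variable R : realType.
Implicit Types u v w : 'M[R]_2.

Lemma kC u v : k u v = k v u.
Proof. exact: mxtrace_mulC. Qed.

Lemma kDl u v w : k (u + v) w = k u w + k v w.
Proof. by rewrite /k mulmxDl mxtraceD. Qed.

Lemma k0l v : k 0 v = 0.
Proof. by rewrite /k mul0mx mxtrace0. Qed.

Lemma kZl a u v : k (a *: u) v = a * k u v.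
Proof. by rewrite /k -scalemxAl mxtraceZ. Qed.

Lemma kZr a u v : k u (a *: v) = a * k u v.
Proof. by rewrite kC kZl kC. Qed.

Lemma k_suml (I : Type) (r : seq I) (P : pred I) (F : I -> 'M[R]_2) v :
  k (\sum_(i <- r | P i) F i) v = \sum_(i <- r | P i) k (F i) v.
Proof. by rewrite /k mulmx_suml raddf_sum. Qed.

(** Pairing with the elementary matrices recovers the entries. *)
Lemma k_nondegenerate u v : (forall w, k u w = k v w) -> u = v.
Proof.
have k_delta x i j : k x (delta_mx j i) = x i j.
  rewrite /k -(mul_delta_mx (0 : 'I_1)) mulmxA mxtrace_mulC.
  by rewrite trace_mx11 -rowE -colE !mxE.
by move=> uv; apply/matrixP => i j; rewrite -!k_delta.
Qed.

Lemma adC u v : ad v u = - ad u v.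
Proof. by rewrite /ad opprB. Qed.

Lemma adZl a u v : ad (a *: u) v = a *: ad u v.
Proof. by rewrite /ad -scalemxAl -scalemxAr scalerBr. Qed.

Lemma adZr a u v : ad u (a *: v) = a *: ad u v.
Proof. by rewrite adC adZl -scalerN -adC. Qed.

Lemma ad0l v : ad 0 v = 0.
Proof. by rewrite /ad mul0mx mulmx0 subrr. Qed.

Lemma ad_jacobi u v w : ad u (ad v w) - ad v (ad u w) = ad (ad u v) w.
Proof.
rewrite /ad !mulmxBl !mulmxBr !mulmxA.
(* The six products are abstracted so that only additions are expanded. *)
move: (u *m v *m w) (u *m w *m v) (v *m u *m w) (v *m w *m u)
  (w *m u *m v) (w *m v *m u) => a b c d e f.
by apply/matrixP => i j; rewrite !mxE; ring.
Qed.

(** This cyclic invariance is the infinitesimal form of the invariance of [k]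
    under conjugation, because [ad] is skew-symmetric. *)
Lemma k_ad_cyclic u v w : k (ad u v) w = k (ad v w) u.
Proof.
rewrite /k /ad !mulmxBl !raddfB /=; congr (_ - _).
  by rewrite -mulmxA mxtrace_mulC.
by rewrite mxtrace_mulC mulmxA.
Qed.

Lemma killingE u v : killing u v = 4 * k u v - 2 * (\tr u * \tr v).
Proof.
have -> : killing u v =
    \tr (lin_mx (fun w => (u *m v) *m w *m 1%:M))
  - \tr (lin_mx (fun w => u *m w *m v))
  - \tr (lin_mx (fun w => v *m w *m u))
  + \tr (lin_mx (fun w => 1%:M *m w *m (v *m u))).
  rewrite -!raddfB -raddfD /=; congr mxtrace.
  apply/matrixP => p; case/mxvec_indexP => i j; rewrite !mxE /= !mxvecE.
  rewrite /ad mulmxBr mulmxBl !mulmx1 !mul1mx !mulmxA !mxE; ring.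
by rewrite !mxtrace_lin_mx_mul mxtrace1 /k (mxtrace_mulC v u); ring.
Qed.
End LieAlgebra.

(** * Differentials of linear maps and openness of the invertible matrices *)

Section Analysis.
Variable R : realFieldType.

(** Right multiplication is a finite sum of coordinates times fixed matrices. *)
Lemma mulmxr_differentiable m n p (v : 'M[R]_(n, p)) (g : 'M[R]_(m, n)) :
  differentiable (fun h : 'M[R]_(m, n) => h *m v) g.
Proof.
have -> : (fun h : 'M[R]_(m, n) => h *m v) =
    \sum_(i < m) \sum_(j < n)
      (fun h : 'M[R]_(m, n) => h i j *: (delta_mx i j *m v)).
  apply/funext => h; rewrite fct_sumE {1}[h]matrix_sum_delta mulmx_suml.
  apply: eq_bigr => i _; rewrite fct_sumE mulmx_suml.
  by apply: eq_bigr => j _; rewrite -scalemxAl.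
apply: differentiable_sum => i; apply: differentiable_sum => j.
exact/differentiableZl/differentiable_coord.
Qed.

Lemma derive_mulmxr m n p (v : 'M[R]_(n, p)) (g w : 'M[R]_(m, n)) :
  'D_w (fun h : 'M[R]_(m, n) => h *m v) g = w *m v.
Proof.
rewrite deriveE; last exact: mulmxr_differentiable.
rewrite (@diff_lin _ _ _ (mulmxr v)) // => h.
exact/differentiable_continuous/mulmxr_differentiable.
Qed.

Lemma det_continuous n : continuous (fun h : 'M[R]_n => \det h).
Proof.
move=> h.
apply: (@cvg_big R _ +%R 0 xpredT (@add_continuous _) _ (nbhs h)) => s _.
apply: (@cvgM R); first exact: cvg_cst.
apply: (@cvg_big R _ *%R 1 xpredT (@mul_continuous _) _ (nbhs h)) => i _.
exact: coord_continuous.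
Qed.

Lemma near_unitmx n (g : 'M[R]_n) :
  g \in unitmx -> \forall h \near g, h \in unitmx.
Proof.
rewrite unitmxE unitfE => det_g.
have det_near : \forall h \near g, \det h != 0.
  have nz_nbhs : nbhs (\det g) [set x | x != 0].
    by apply: open_nbhs_nbhs; split; [exact: open_neq | ].
  exact: (@det_continuous n g _ nz_nbhs).
by near do rewrite unitmxE unitfE.
Unshelve. all: by end_near. Qed.
End Analysis.

(** * Left-invariant fields and their Levi-Civita connection *)

Section LeftInvariantFields.
Variable R : realType.
Implicit Types (u v w g : 'M[R]_2) (D : vfield R -> vfield R -> vfield R).

Lemma G0_unitmx g : G0 g -> g \in unitmx.
Proof. by move=> /connected_component_sub. Qed.

Lemma lie_left_inv u v : lie (left_inv u) (left_inv v) = left_inv (ad u v).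
Proof.
apply/funext => g; rewrite /lie /left_inv !derive_mulmxr.
by rewrite -!mulmxA -mulmxBr.
Qed.

Lemma kplus_left_inv g u v :
  g \in unitmx -> kplus g (left_inv u g) (left_inv v g) = k u v.
Proof. by move=> gU; rewrite /kplus /left_inv !mulKmx. Qed.

Lemma curv_left_inv u v w :
  curv (left_inv u) (left_inv v) (left_inv w) =
  left_inv (4^-1 *: ad (ad u v) w).
Proof.
by apply/funext => g; rewrite /curv !lie_left_inv /left_inv -scalemxAr.
Qed.

Lemma sec_curv_left_inv u v g : g \in unitmx ->
  sec_curv (left_inv u) (left_inv v) g =
  4^-1 * (k (ad u v) (ad u v) / (k u u * k v v - k u v ^+ 2)).
Proof. by move=> gU; rewrite /sec_curv lie_left_inv !kplus_left_inv. Qed.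

Lemma ricci_left_inv u v g : g \in unitmx ->
  ricci (left_inv u) (left_inv v) g = - (4^-1 * killing u v).
Proof. by move=> gU; rewrite /ricci /left_inv !mulKmx. Qed.

(** Left translations cancel against the inverse in [kplus]; right translations
    act by a conjugation, which the trace does not see. *)
Lemma kplus_bi_invariant : bi_invariant (@kplus R).
Proof.
move=> g h x y /G0_unitmx gU /G0_unitmx hU.
have invM (a b : 'M[R]_2) : a \in unitmx -> b \in unitmx ->
    invmx (a *m b) = invmx b *m invmx a by exact: (@invrM 'M[R]_2).
rewrite /kplus !invM // -!mulmxA !mulKmx //; split=> //.
rewrite /k -!mulmxA mxtrace_mulC !mulmxA.
by rewrite -!mulmxA mulmxV // mulmx1 !mulmxA mulmxK.
Qed.

(** Writing A x y for D_x y at [g] translated back to the identity, metric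
    compatibility makes A x skew-symmetric for [k] and torsion-freeness says
    that A x y - A y x = [x,y].  The three torsion and three metric equations
    for u, v, w are linear in the numbers k(A x y, z) and determine them. *)
Lemma koszul D : levi_civita D -> forall u v g, G0 g ->
  D (left_inv u) (left_inv v) g = 2^-1 *: left_inv (ad u v) g.
Proof.
move=> DP u v g G0g; have gU := G0_unitmx G0g.
have dif w : differentiable_field (left_inv w).
  by move=> h _; exact: mulmxr_differentiable.
pose A x y := invmx g *m D (left_inv x) (left_inv y) g.
have A_skew x y z : k (A z x) y + k (A z y) x = 0.
  have := lc_metric DP (left_inv z) (dif x) (dif y) G0g.
  (* The metric of two left-invariant fields is constant near g. *)
  rewrite (near_eq_derive (g := cst (k x y))); last first.
    by near do rewrite kplus_left_inv//; exact: near_unitmx.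
  rewrite derive_cst /kplus /left_inv !(mulKmx gU) => /esym <-.
  by rewrite [k (A z y) x]kC.
have A_torsion x y : A x y - A y x = ad x y.
  rewrite /A -mulmxBr (lc_torsion_free DP (dif x) (dif y) G0g).
  by rewrite lie_left_inv /left_inv mulKmx.
suff -> : D (left_inv u) (left_inv v) g = g *m A u v.
  rewrite scalemxAr; congr (_ *m _).
  apply: k_nondegenerate => w; rewrite kZl.
  have torsion_k x y z : k (A x y) z = k (A y x) z + k (ad x y) z.
    by rewrite -A_torsion -kDl addrC subrK.
  have := k_ad_cyclic u v w; have := k_ad_cyclic v w u.
  have := A_skew v w u; have := A_skew u w v; have := A_skew u v w.
  have := torsion_k u v w; have := torsion_k v w u; have := torsion_k w u v.
  lra.
by rewrite /A mulKVmx.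
Unshelve. all: by end_near. Qed.

(** The curvature is [[u,v],w]/2 - ([u,[v,w]] - [v,[u,w]])/4, and the Jacobi
    identity turns the second term into [[u,v],w]/4.  Locality of [D] is what
    allows D_y z, known only on G0, to be replaced by a left-invariant field. *)
Lemma curvature_left_inv D : levi_civita D -> forall u v w g, G0 g ->
  curvature_of D (left_inv u) (left_inv v) (left_inv w) g =
  curv (left_inv u) (left_inv v) (left_inv w) g.
Proof.
move=> DP u v w g G0g.
have DD x y z : D (left_inv x) (D (left_inv y) (left_inv z)) g =
    4^-1 *: left_inv (ad x (ad y z)) g.
  rewrite (lc_local DP (X' := left_inv x) (Y' := left_inv (2^-1 *: ad y z))) //.
    rewrite koszul // adZr /left_inv -scalemxAr scalerA; congr (_ *: _); lra.
  by move=> h G0h; rewrite koszul // /left_inv -scalemxAr.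
rewrite /curvature_of curv_left_inv lie_left_inv !DD koszul // -scalerBr.
rewrite /left_inv -mulmxBr ad_jacobi -scalemxAr -scalerBl; congr (_ *: _); lra.
Qed.
End LeftInvariantFields.

(** * The orthonormal basis *)

Section OrthonormalBasis.
Variable R : realType.
Implicit Types a b c d : R.

Lemma scale_mx22 x a b c d :
  x *: mx22 a b c d = mx22 (x * a) (x * b) (x * c) (x * d).
Proof. by apply/matrixP=> i j; rewrite !mxE; do 2!case: ifP. Qed.

Lemma mul_mx22 a b c d a' b' c' d' :
  mx22 a b c d *m mx22 a' b' c' d' =
  mx22 (a * a' + b * c') (a * b' + b * d') (c * a' + d * c') (c * b' + d * d').
Proof.
apply/matrixP => i j; rewrite !mxE 2!big_ord_recl big_ord0 !mxE /= addr0.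
by do 2!case: ifP.
Qed.

Lemma sub_mx22 a b c d a' b' c' d' :
  mx22 a b c d - mx22 a' b' c' d' = mx22 (a - a') (b - b') (c - c') (d - d').
Proof. by apply/matrixP => i j; rewrite !mxE; do 2!case: ifP. Qed.

Lemma mxtrace_mx22 a b c d : \tr (mx22 a b c d) = a + d.
Proof. by rewrite /mxtrace 2!big_ord_recl big_ord0 !mxE /= addr0. Qed.

Let rt2_sqr : Num.sqrt 2 ^+ 2 = 2 :> R.
Proof. by rewrite sqr_sqrtr. Qed.

Lemma ad_half_sqrt2 (A B : 'M[R]_2) :
  ad ((Num.sqrt 2 / 2) *: A) ((Num.sqrt 2 / 2) *: B) = 2^-1 *: ad A B.
Proof.
by rewrite adZl adZr scalerA; congr (_ *: _); move: rt2_sqr; lra.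
Qed.

Lemma sqrt2_half_sqrt2 (A : 'M[R]_2) :
  Num.sqrt 2 *: ((Num.sqrt 2 / 2) *: A) = A.
Proof.
by rewrite scalerA -[RHS]scale1r; congr (_ *: _); move: rt2_sqr; lra.
Qed.

Lemma k_half_sqrt2 (A B : 'M[R]_2) :
  k ((Num.sqrt 2 / 2) *: A) ((Num.sqrt 2 / 2) *: B) = 2^-1 * k A B.
Proof. by rewrite kZl kZr mulrA; congr (_ * _); move: rt2_sqr; lra. Qed.

Lemma ad_mx22 a b c d a' b' c' d' :
  ad (mx22 a b c d) (mx22 a' b' c' d') =
  mx22 (b * c' - b' * c) (a * b' + b * d' - (a' * b + b' * d))
       (c * a' + d * c' - (c' * a + d' * c)) (c * b' - c' * b).
Proof. rewrite /ad !mul_mx22 sub_mx22; congr mx22; ring. Qed.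

Lemma k_mx22 a b c d a' b' c' d' :
  k (mx22 a b c d) (mx22 a' b' c' d') = a * a' + b * c' + (c * b' + d * d').
Proof. by rewrite /k mul_mx22 mxtrace_mx22. Qed.

Lemma ad12 : ad e1 e2 = Num.sqrt 2 *: e3 :> 'M[R]_2.
Proof.
rewrite sqrt2_half_sqrt2 ad_half_sqrt2 ad_mx22 scale_mx22.
by congr mx22; lra.
Qed.

Lemma ad13 : ad e1 e3 = - Num.sqrt 2 *: e2 :> 'M[R]_2.
Proof.
rewrite scaleNr sqrt2_half_sqrt2 ad_half_sqrt2 ad_mx22 -scaleN1r !scale_mx22.
by congr mx22; lra.
Qed.

Lemma ad23 : ad e2 e3 = - Num.sqrt 2 *: e1 :> 'M[R]_2.
Proof.
rewrite scaleNr sqrt2_half_sqrt2 ad_half_sqrt2 ad_mx22 -scaleN1r !scale_mx22.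
by congr mx22; lra.
Qed.

Lemma e4_scalar : e4 = (Num.sqrt 2 / 2)%:M :> 'M[R]_2.
Proof.
rewrite /e4 -[RHS]scalemx1; congr (_ *: _); apply/matrixP => i j.
by rewrite !mxE; case: i j => [[|[|//]] ?] [[|[|//]] ?].
Qed.

Lemma ad_scalar_mx x (u : 'M[R]_2) : ad u x%:M = 0.
Proof. by rewrite /ad scalar_mxC subrr. Qed.

(** The commutator table as a single rewriting rule; quantified members cover
    the diagonal and the central element [e4]. *)
Lemma adE :
  ((ad e1 e2 = Num.sqrt 2 *: e3 :> 'M[R]_2) *
   (ad e1 e3 = - Num.sqrt 2 *: e2 :> 'M[R]_2) *
   (ad e2 e3 = - Num.sqrt 2 *: e1 :> 'M[R]_2) *
   (ad e2 e1 = - Num.sqrt 2 *: e3 :> 'M[R]_2) *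
   (ad e3 e1 = Num.sqrt 2 *: e2 :> 'M[R]_2) *
   (ad e3 e2 = Num.sqrt 2 *: e1 :> 'M[R]_2)) *
  ((forall u : 'M[R]_2, ad u u = 0) *
   (forall u : 'M[R]_2, ad u e4 = 0) *
   (forall u : 'M[R]_2, ad e4 u = 0)).
Proof.
have ad_e4 (u : 'M[R]_2) : ad u e4 = 0 by rewrite e4_scalar ad_scalar_mx.
do !split; rewrite ?ad12 ?ad13 ?ad23 //.
- by rewrite adC ad12 scaleNr.
- by rewrite adC ad13 scaleNr opprK.
- by rewrite adC ad23 scaleNr opprK.
- by move=> u; rewrite /ad subrr.
- by move=> u; rewrite adC ad_e4 oppr0.
Qed.

Lemma k_e (i j : 'I_4) :
  k (e i) (e j) = (if i == 0 then -1 else 1) *+ (i == j) :> R.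
Proof.
rewrite /e !(tnth_nth 0).
by case: i j => [[|[|[|[|//]]]] ?] [[|[|[|[|//]]]] ?] /=;
  rewrite k_half_sqrt2 k_mx22 ?mulr1n ?mulr0n /=; lra.
Qed.

Lemma kE :
  (k e1 e1 = -1 :> R) * (k e2 e2 = 1 :> R) * (k e3 e3 = 1 :> R) *
  (k e4 e4 = 1 :> R) * (k e1 e2 = 0 :> R) * (k e1 e3 = 0 :> R) *
  (k e1 e4 = 0 :> R) * (k e2 e3 = 0 :> R) * (k e2 e4 = 0 :> R) *
  (k e3 e4 = 0 :> R).
Proof.
by do !split; [exact: (k_e 0 0) | exact: (k_e 1 1) | exact: (k_e 2 2) |
  exact: (k_e 3 3) | exact: (k_e 0 1) | exact: (k_e 0 2) | exact: (k_e 0 3) |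
  exact: (k_e 1 2) | exact: (k_e 1 3) | exact: (k_e 2 3)].
Qed.

(** The three planes in the span of e1, e2, e3 have the same curvature: for the
    plane of e2 and e3 both k([u,v],[u,v]) and the Gram determinant change
    sign. *)
Lemma sec_curv_e (i j : 'I_4) (g : 'M[R]_2) : g \in unitmx -> (i < j)%N ->
  sec_curv (left_inv (e i)) (left_inv (e j)) g =
  if j == ord_max then 0 else - 2^-1.
Proof.
move=> gU; rewrite sec_curv_left_inv // /e !(tnth_nth 0).
move: rt2_sqr; rewrite expr2 => rt2.
by case: i j => [[|[|[|[|//]]]] ?] [[|[|[|[|//]]]] ?] //= _;
  (* The basis vectors unfold to scalar multiples, so kZl and kZr are applied
     exactly once, to expose the coefficients of the brackets. *)
  rewrite !kE !adE ?k0l 1?kZl 1?kZr ?kE expr0n;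
  rewrite !(mulN1r, mul1r, subr0, invrN, invr1); lra.
Qed.

Lemma mxtrace_e (i : 'I_4) :
  \tr (e i) = if i == ord_max then Num.sqrt 2 else 0 :> R.
Proof.
rewrite /e !(tnth_nth 0).
by case: i => [[|[|[|[|//]]]] ?] /=; rewrite mxtraceZ mxtrace_mx22; lra.
Qed.

Lemma killing_e (i j : 'I_4) :
  killing (e i) (e j) =
  (if i == 0 then -4 else if i == ord_max then 0 else 4) *+ (i == j) :> R.
Proof.
rewrite killingE k_e !mxtrace_e; move: rt2_sqr.
by case: i j => [[|[|[|[|//]]]] ?] [[|[|[|[|//]]]] ?] /=;
  rewrite ?mulr1n ?mulr0n /=; lra.
Qed.

(** Orthogonal vectors of nonzero square are independent, and there are
    4 = dim 'M_2 of them. *)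
Lemma e_basis : basis_of (fullv : {vspace 'M[R]_2}) [seq e i | i <- enum 'I_4].
Proof.
rewrite [map _ _](map_tnth_enum [tuple e1; e2; e3; e4]).
rewrite basisEfree subvf dimvf dim_matrix andbT.
apply/freeP => c c0 i.
have : k (\sum_(j < 4) c j *: e j) (e i) = 0.
  rewrite (eq_bigr _ (fun j _ => congr1 _ (tnth_nth 0 _ j))) c0.
  exact: k0l.
rewrite k_suml (bigD1 i) //= kZl big1 => [|j ji]; last first.
  by rewrite kZl k_e (negPf ji) mulr0.
rewrite addr0 k_e eqxx => /eqP; rewrite mulf_eq0 => /orP[/eqP//|].
by case: ifP => _; rewrite ?mulr1n ?oppr_eq0 oner_eq0.
Qed.
End OrthonormalBasis.

Theorem lemma3 (R : realType) :
  (* the bi-invariant Lorentzian metric, its connection, orthonormal basis *)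
  [/\ bi_invariant (@kplus R),
      (forall (D : vfield R -> vfield R -> vfield R), levi_civita D ->
       forall (u v w g : 'M[R]_2), G0 g ->
         D (left_inv u) (left_inv v) g = 2^-1 *: left_inv (ad u v) g /\
         curvature_of D (left_inv u) (left_inv v) (left_inv w) g =
         curv (left_inv u) (left_inv v) (left_inv w) g),
      basis_of (fullv : {vspace 'M[R]_2}) [seq e i | i <- enum 'I_4],
      [/\ k (@e1 R) e1 = -1, k (@e2 R) e2 = 1, k (@e3 R) e3 = 1
        & k (@e4 R) e4 = 1] &
      (forall i j : 'I_4, i != j -> k (@e R i) (e j) = 0)]
  /\
  (* curvature tensor *)
  (forall g : 'M[R]_2, G0 g ->
   let Rm u v w := curv (left_inv u) (left_inv v) (left_inv w) g in
   let f u := left_inv u g in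
   [/\ [/\ Rm e1 e2 e1 = 2^-1 *: f e2, Rm e1 e2 e2 = 2^-1 *: f e1,
           Rm e1 e3 e1 = 2^-1 *: f e3 & Rm e1 e3 e3 = 2^-1 *: f e1],
       [/\ Rm e2 e1 e1 = - 2^-1 *: f e2, Rm e2 e1 e2 = - 2^-1 *: f e1,
           Rm e2 e3 e2 = - 2^-1 *: f e3 & Rm e2 e3 e3 = 2^-1 *: f e2],
       [/\ Rm e3 e1 e1 = - 2^-1 *: f e3, Rm e3 e1 e3 = - 2^-1 *: f e1,
           Rm e3 e2 e2 = 2^-1 *: f e3 & Rm e3 e2 e3 = - 2^-1 *: f e2] &
       forall i j l : 'I_4,
         (i.+1, j.+1, l.+1) \notin
           [:: (1, 2, 1); (1, 2, 2); (1, 3, 1); (1, 3, 3);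
               (2, 1, 1); (2, 1, 2); (2, 3, 2); (2, 3, 3);
               (3, 1, 1); (3, 1, 3); (3, 2, 2); (3, 2, 3)]%N ->
         Rm (e i) (e j) (e l) = 0])
  /\
  (* sectional curvature *)
  (forall g : 'M[R]_2, G0 g ->
   let K u v := sec_curv (left_inv u) (left_inv v) g in
   [/\ K e1 e2 = - 2^-1, K e1 e3 = - 2^-1 & K e2 e3 = - 2^-1] /\
   [/\ K e1 e4 = 0, K e2 e4 = 0 & K e3 e4 = 0])
  /\
  (* scalar curvature *)
  (forall g : 'M[R]_2, G0 g -> scal_curv e g = -3)
  /\
  (* Cartan-Killing form *)
  [/\ killing (@e1 R) e1 = -4, killing (@e2 R) e2 = 4, killing (@e3 R) e3 = 4,
      killing (@e4 R) e4 = 0 &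
      forall i j : 'I_4, i != j -> killing (@e R i) (e j) = 0]
  /\
  (* Ricci tensor *)
  (forall g : 'M[R]_2, G0 g ->
   let Ric u v := ricci (left_inv u) (left_inv v) g in
   [/\ Ric e1 e1 = 1, Ric e2 e2 = -1, Ric e3 e3 = -1, Ric e4 e4 = 0 &
       forall i j : 'I_4, i != j -> Ric (e i) (e j) = 0]).
Proof.
split; [split | split; [|split; [|split; [|split]]]].
- exact: kplus_bi_invariant.
- by move=> D DP u v w g G0g; rewrite koszul // curvature_left_inv.
- exact: e_basis.
- by rewrite !kE.
- by move=> i j ij; rewrite k_e (negPf ij).
- move=> g G0g Rm f.
  have RmE u v w : Rm u v w = f (4^-1 *: ad (ad u v) w).
    by rewrite /Rm curv_left_inv.
  have rt2 : Num.sqrt 2 * Num.sqrt 2 = 2 :> R by rewrite -expr2 sqr_sqrtr.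
  have fZ a u : f (a *: u) = a *: f u by rewrite /f /left_inv scalemxAr.
  have f0 : f 0 = 0 by rewrite /f /left_inv mulmx0.
  split.
  1-3: split; rewrite RmE !(adE, adZl) !fZ 2!scalerA; congr (_ *: _); lra.
  move=> i j l; rewrite RmE /e !(tnth_nth 0).
  case: i j l => [[|[|[|[|//]]]] ?] [[|[|[|[|//]]]] ?] [[|[|[|[|//]]]] ?] //= _;
  by rewrite !(adE, adZl, ad0l, scaler0, f0).
- move=> g /G0_unitmx gU K.
  split; split; [exact: (@sec_curv_e _ 0 1) | exact: (@sec_curv_e _ 0 2) |
    exact: (@sec_curv_e _ 1 2) | exact: (@sec_curv_e _ 0 3) |
    exact: (@sec_curv_e _ 1 3) | exact: (@sec_curv_e _ 2 3)].
- move=> g /G0_unitmx gU; rewrite /scal_curv.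
  under eq_bigr => i _ do under eq_bigr => j ij do rewrite (sec_curv_e gU ij).
  under eq_bigr do rewrite big_mkcond.
  by rewrite !(big_ord_recl, big_ord0) /=; lra.
- split; [exact: (killing_e R 0 0) | exact: (killing_e R 1 1) |
    exact: (killing_e R 2 2) | exact: (killing_e R 3 3) | ].
  by move=> i j ij; rewrite killing_e (negPf ij).
- move=> g /G0_unitmx gU Ric.
  split; last by move=> i j ij;
    rewrite /Ric ricci_left_inv // killing_e (negPf ij) mulr0 oppr0.
  all: rewrite /Ric ricci_left_inv //.
  - by rewrite (killing_e R 0 0) /=; lra.
  - by rewrite (killing_e R 1 1) /=; lra.
  - by rewrite (killing_e R 2 2) /=; lra.
  - by rewrite (killing_e R 3 3) /=; lra.
Qed.
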